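(* A tree $T$ has $\gamma_{\mathrm{m}}^{\infty}(T) < 1 + \gamma_c(T)$ if and only if $T$ has a spanning forest consisting of $r$ copies of $K_2$ and trees $T_1, T_2, \ldots, T_k$ on at least three vertices (for some integers $r, k \geq 0$) such that at least $k$ loners of $T$ are leaves of the $k+r$ trees in the collection.
   Context: All graphs are finite. For a graph $G=(V,E)$, the $\mathrm{m}$-eternal dominating set game is played as follows. The defender chooses a set $D_1\subseteq V$ of vertices occupied by guards (at most one guard per vertex). For each $i\ge 1$, the attacker (who sees the guard positions) chooses a vertex $r_i\in V\setminus D_i$, and the defender responds by letting each guard either stay in place or move to an adjacent vertex, producing a new set $D_{i+1}$ (again with at most one guard per vertex, so $|D_{i+1}|=|D_i|$) with $r_i\in D_{i+1}$. Every $D_i$ is required to be a dominating set, i.e. every vertex outside $D_i$ has a neighbor in $D_i$. The $\mathrm{m}$-eternal domination number $\gamma_{\mathrm{m}}^{\infty}(G)$ is the least number of guards with which the defender can successfully respond to every infinite sequence of attacks. $\gamma_c(G)$ is the minimum size of a connected dominating set of $G$, i.e. a dominating set inducing a connected subgraph. A leaf of a tree is a vertex of degree one (so both vertices of $K_2$ are leaves). An internal vertex is a vertex that is not a leaf. A loner of $T$ is an internal vertex of $T$ that is adjacent to no leaf of $T$.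
   Formalization: The tree T is required to have at least two vertices, because for the one-vertex tree both domination numbers equal 1, so the inequality holds, but no spanning forest of copies of K_2 and trees on at least three vertices exists. *)

(* Defs.v *)
From mathcomp Require Import all_boot.
From mathcomp Require Import boolp.

Set Implicit Arguments.
Unset Strict Implicit.
Unset Printing Implicit Defensive.

(* A finite graph is a finType V with an edge relation e : rel V; simplicity
   (symmetry and irreflexivity of e) is part of is_tree. *)

Section Graphs.
Variable V : finType.
Implicit Types (e f : rel V) (x y : V) (C D : {set V}).

Definition degree e x : nat := #|[set y | e x y]|.

Definition leaf e x : bool := degree e x == 1.

Definition loner e x : bool :=
  ~~ leaf e x && [forall y, e x y ==> ~~ leaf e y].

(* A ucycle of length 2 only traverses an edge back and forth. *)
Definition acyclic e : Prop := forall c : seq V, ucycle e c -> size c <= 2.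

Definition is_forest e : Prop :=
  [/\ symmetric e, irreflexive e & acyclic e].

Definition is_tree e : Prop :=
  [/\ is_forest e, 0 < #|V| & forall x y, connect e x y].

Definition is_spanning_forest f e : Prop := is_forest f /\ subrel f e.

Definition components f : {set {set V}} :=
  equivalence_partition (connect f) [set: V].

Definition is_K2 f C : bool := [exists x, exists y, f x y && (C == [set x; y])].

(* For a forest f, each component is a tree and the degree of a vertex in its
   component is its degree in f. *)
Definition has_components f (r k : nat) : Prop :=
  [/\ forall C, C \in components f -> is_K2 f C \/ 3 <= #|C|,
      #|[set C in components f | is_K2 f C]| = r
    & #|[set C in components f | 3 <= #|C|]| = k].

Definition dominating e D : bool :=
  [forall x, (x \notin D) ==> [exists y in D, e x y]].

Definition connected_in e D : bool :=
  [forall x in D, forall y in D,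
     connect [rel u v | [&& u \in D, v \in D & e u v]] x y].

(* The default [set: V] is itself a connected dominating set when the graph is
   connected; gamma_c is only meaningful in that case. *)
Definition gamma_c e : nat :=
  #|[arg min_(D < [set: V] | dominating e D && connected_in e D) #|D|]|.

(* g describes the simultaneous move of the guards on D. *)
Definition guards_move e D D' : Prop :=
  exists g : V -> V,
    [/\ {in D &, injective g},
        {in D, forall x, g x = x \/ e x (g x)}
      & D' = g @: D].

(* A defender strategy maps the list of attacks made so far to the set of
   occupied vertices; its value at [::] is the initial set. Against the attack
   sequence att, the set occupied once the first i attacks have been answered
   is position s att i. *)
Definition position (s : seq V -> {set V}) (att : nat -> V) (i : nat) : {set V} :=
  s (mkseq att i).

(* Legality is only required of the attacks made up to step i, so that the
   defender must also answer the attacks preceding an illegal one. *)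
Definition winning e (s : seq V -> {set V}) : Prop :=
  dominating e (s [::]) /\
  forall (att : nat -> V) (i : nat),
    (forall j, j <= i -> att j \notin position s att j) ->
    [/\ guards_move e (position s att i) (position s att i.+1),
        att i \in position s att i.+1
      & dominating e (position s att i.+1)].

Definition defendable e (n : nat) : Prop :=
  exists s : seq V -> {set V}, #|s [::]| = n /\ winning e s.

Lemma defendable_exists e : exists n, `[< defendable e n >].
Proof.
exists #|[set: V]|; apply/asboolP; exists (fun=> [set: V]); split=> //.
split; first by apply/forallP => x; rewrite in_setT.
by move=> att i /(_ i (leqnn i)); rewrite in_setT.
Qed.

Definition gamma_m_eternal e : nat := ex_minn (defendable_exists e).

End Graphs.

(* Main.v *)
(** Root the tree at a vertex that has a leaf child and label the vertices bottom-up: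
a vertex carries the label L unless exactly one of its children does. Call the
labelling good if the root is not in L or some internal vertex has no child in L.

If the labelling is good, joining every vertex of L to its parent gives a spanning
forest without isolated vertices. Occupying its internal vertices and one leaf per
component is an eternal defence with at most gamma_c guards (an attacked leaf is
reached by shifting the guards along a path). The top of a large component other than
the root's is a loner leaf, and an internal vertex with no child in L is one for the
root's component if that is large, so k loners of the tree are leaves of the forest.

If the labelling is bad, then by induction every subtree always holds at least as
many guards as it has internal vertices, and one attack forces an extra guard into a
subtree whose top is in L; at the root this gives more guards than internal vertices.
Moreover a double count over parents and children shows that any spanning forest
without isolated vertices has fewer loner leaves than large components. *)

Require Import Defs.
From mathcomp Require Import all_boot.
From mathcomp Require Import boolp.

Set Implicit Arguments.
Unset Strict Implicit.
Unset Printing Implicit Defensive.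

(** * Leaves and their neighbours *)

Section Leaves.
Variables (V : finType) (e : rel V).
Implicit Types x y z : V.

Lemma leaf_uniq x y z : leaf e x -> e x y -> e x z -> y = z.
Proof.
case/cards1P=> t Dt exy exz.
have := in_set (e x) y; rewrite exy Dt => /set1P ->.
by have := in_set (e x) z; rewrite exz Dt => /set1P ->.
Qed.

Lemma leafPn x y : e x y -> reflect (exists2 z, e x z & z != y) (~~ leaf e x).
Proof.
move=> exy; apply: (iffP idP) => [nlx | [z exz zy]]; last first.
  by apply/negP=> lx; rewrite (leaf_uniq lx exz exy) eqxx in zy.
apply/exists_inP; apply: contraNT nlx => /exists_inPn no.
apply/cards1P; exists y; apply/setP=> z; rewrite !inE.
by apply/idP/eqP=> [/no /negPn/eqP | ->].
Qed.

Lemma leaf1 x y : e x y -> (forall z, e x z -> z = y) -> leaf e x.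
Proof. by move=> exy xy; apply/negPn/(leafPn exy) => -[z /xy -> /eqP]. Qed.

Lemma connect_pair x y z : (forall t, e x t -> t = y) -> (forall t, e y t -> t = x) ->
  connect e x z -> z \in [set x; y].
Proof.
move=> ex ey /connectP [p]; elim: p x y ex ey => [|t p IH] x y ex ey /=.
  by move=> _ ->; rewrite set21.
by case/andP=> /ex -> pt Dz; rewrite setUC; apply: IH.
Qed.

End Leaves.

(** * Cycle avoidance in trees and the choice of a rooting *)

Section Rooting.
Variables (V : finType) (e : rel V).
Hypothesis e_tree : is_tree e.

(** A path between the two neighbours that avoids [v] would close up through [v] to a cycle with at
    least three vertices. *)
Lemma avoiding_cycle v x y : e v x -> e v y -> x != y ->
  ~~ connect [rel s t | [&& s != v, t != v & e s t]] x y.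
Proof.
have [[esym eirr eacy] _ _] := e_tree.
move=> evx evy xy; apply/negP=> /connectP [p0 p0P y_p0].
move: p0P y_p0; case/shortenP=> p pP p_uniq _ y_p.
have /eacy : ucycle e [:: v, x & p].
  rewrite /ucycle /= rcons_path evx -y_p esym evy !andbT.
  have [-> nv] : path e x p /\ v \notin x :: p.
    have xv : v != x by apply: contraTneq evx => ->; rewrite eirr.
    elim: p x pP xv {p_uniq y_p evx xy} => [|z p IH] x /=.
      by rewrite inE => _ ->.
    case/andP=> /and3P [_ zv ->] pP xv; rewrite eq_sym in zv.
    by case: (IH z pP zv) => -> vzp; rewrite inE negb_or xv vzp.
  by rewrite nv.
case: p y_p {pP p_uniq} => //= yx _; by rewrite yx eqxx in xy.
Qed.

(** A detour around the edge, closed by the edge itself, would be a cycle on at least three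
    vertices. *)
Lemma avoiding_edge x y : e x y ->
  ~~ connect [rel s t | e s t && ~~ [|| (s == x) && (t == y) | (s == y) && (t == x)]] x y.
Proof.
have [[esym eirr eacy] _ _] := e_tree.
move=> exy; apply/negP=> /connectP [p0 p0P y_p0].
move: p0P y_p0; case/shortenP=> p pP p_uniq _ y_p.
have /eacy : ucycle e (x :: p).
  rewrite /ucycle p_uniq andbT /= rcons_path -y_p esym exy andbT.
  by apply: sub_path pP => s t /andP [].
case: p pP y_p {p_uniq} => [|z [|]] //=; first by move=> _ yx; rewrite yx eirr in exy.
by move=> + Dz; rewrite -Dz !eqxx /= andbF.
Qed.

End Rooting.

(** The root is made its own parent so that [par] is total; hence parent edges carry the guard
    [v != root]. *)
Definition rooting (V : finType) (e : rel V) (root : V) (par : V -> V) (depth : V -> nat) :=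
  [/\ par root = root,
      forall v, v != root -> depth v = (depth (par v)).+1
    & forall x y, e x y = (x != root) && (y == par x) || (y != root) && (x == par y)].

(** Depth is the distance from the root, and a parent is a neighbour one step closer. Any further
    edge could be bypassed by climbing from both of its ends to the root, against
    [avoiding_edge]. *)
Lemma rooting_exists (V : finType) (e : rel V) root : is_tree e ->
  exists par depth, rooting e root par depth.
Proof.
move=> e_tree; have [[esym eirr _] _ econn] := e_tree.
pose reach v n := [exists p : n.-tuple V, path e root p && (last root p == v)].
have reach_ex v : exists n, reach v n.
  have /connectP [p pP ->] := econn root v.
  by exists (size p); apply/existsP; exists (in_tuple p); rewrite pP /=.
pose d v := ex_minn (reach_ex v).
have d_le p : path e root p -> d (last root p) <= size p.
  move=> pP; rewrite /d; case: ex_minnP => n _; apply.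
  by apply/existsP; exists (in_tuple p); rewrite pP /=.
have d_path v : exists p, [/\ path e root p, last root p = v & size p = d v].
  rewrite /d; case: ex_minnP => n /existsP [p /andP [pP /eqP Dv]] _.
  by exists p; rewrite size_tuple.
have d_root : d root = 0 by apply/eqP; rewrite -leqn0; apply: (d_le [::]).
(* The default [root] is taken only at the root, which has no closer neighbour. *)
pose par v := odflt root [pick y | e v y && (d v == (d y).+1)].
have par_root : par root = root by rewrite /par; case: pickP => //= y; rewrite d_root andbF.
have parP v : v != root -> e v (par v) /\ d v = (d (par v)).+1.
  move=> vr; rewrite /par; case: pickP => /= [y /andP [? /eqP ?] // | no].
  have [p [+ + szp]] := d_path v; case: (lastP p) szp => [|q y].
    by move=> _ _ /= rv; rewrite rv eqxx in vr.
  rewrite size_rcons last_rcons rcons_path => szq /andP [qP eqy] Dy; subst y.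
  have /negP [] := no (last root q); rewrite esym eqy -szq eqSS eqn_leq d_le // andbT.
  have [q' [q'P Dq sq]] := d_path (last root q).
  have := d_le (rcons q' v); rewrite rcons_path q'P Dq eqy last_rcons size_rcons sq -szq.
  exact.
exists par, d; split=> // [v /parP [] //|x y].
apply/idP/idP => [exy | /orP [] /andP [/parP [+ _] /eqP ->] //]; last by rewrite esym.
apply: contraT => nxy; have /negP [] := avoiding_edge e_tree exy.
set e' := (X in connect X).
have e'sym : symmetric e'.
  by move=> s t; rewrite /e' /= esym; congr (_ && ~~ _); rewrite orbC ![(s == _) && _]andbC.
have up v : connect e' root v.
  have [n] := ubnP (d v); elim: n v => // n IH v vn.
  have [-> // | vr] := eqVneq v root; have [ev dv] := parP v vr.
  apply: connect_trans (IH (par v) _) (connect1 _); first by rewrite dv in vn.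
  rewrite e'sym /e' /= ev /=; apply: contra nxy => /orP [] /andP [/eqP Dv /eqP Dp].
    by rewrite -Dv vr -Dp eqxx.
  by rewrite -Dv vr -Dp eqxx orbT.
by apply: connect_trans (up y); rewrite (sym_connect_sym e'sym) up.
Qed.

(** * Strategies as families of safe configurations, and the two domination numbers *)

Section Game.
Variables (V : finType) (e : rel V).
Implicit Types (D : {set V}) (F : {set V} -> Prop).

(** A history-free form of a winning strategy: a family of dominating sets within which every attack
    can be answered. *)
Definition secure F := forall D, F D ->
  dominating e D /\
  forall r, r \notin D -> exists D', [/\ F D', guards_move e D D' & r \in D'].

Lemma guards_move_card D D' : guards_move e D D' -> #|D'| = #|D|.
Proof. by case=> g [ginj _ ->]; rewrite card_in_imset. Qed.

Lemma secure_defendable F D : secure F -> F D -> defendable e #|D|.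
Proof.
move=> Fsec FD.
(* Outside [F], or against an illegal attack, the answer is irrelevant; making it total allows a
   choice function. *)
have respond D' r : exists D'', F D' -> r \notin D' ->
    [/\ F D'', guards_move e D' D'' & r \in D''].
  have [[FD' rD']|no] := pselect (F D' /\ r \notin D').
    by have [_ /(_ r rD') [D'' ?]] := Fsec _ FD'; exists D''.
  by exists D' => FD' rD'; case: no.
pose step D' r := sval (cid (respond D' r)).
pose s h := foldl step D h.
exists s; split=> //; split; first by have [] := Fsec _ FD.
move=> att i legal.
have posS j : position s att j.+1 = step (position s att j) (att j).
  by rewrite /position /s mkseqS foldl_rcons.
have Fpos j : j <= i.+1 -> F (position s att j).
  elim: j => // j IH ji; rewrite posS.
  by case: (svalP (cid (respond (position s att j) (att j)))) => //;
    [apply: IH; apply: ltnW | apply: legal].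
have [dom _] := Fsec _ (Fpos i.+1 (leqnn _)).
rewrite posS in dom *; split=> //;
  by case: (svalP (cid (respond (position s att i) (att i)))) => //; [apply: Fpos | apply: legal].
Qed.

(** The family consists of the positions that the strategy reaches after finite legal histories. *)
Lemma defendable_secure n : defendable e n ->
  exists F, secure F /\ exists2 D, F D & #|D| = n.
Proof.
case=> s [sn [s0 swin]].
pose legal h := forall j, j < size h -> forall x, nth x h j \notin s (take j h).
exists (fun D => exists2 h, legal h & D = s h); split; last by exists (s [::]); first exists [::].
have mk h x j : j <= size h -> mkseq (nth x h) j = take j h.
  by move=> jh; rewrite -(map_nth_iota0 x) // /mkseq.
move=> _ [h hl ->]; split.
  case/lastP: h hl => // h x hl.
  (* A finite history is extended to an infinite attack sequence by a default value; legality is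
     required only up to the current step. *)
  have [|_ _] := swin (nth x (rcons h x)) (size h).
    by move=> j jh; rewrite /position mk; [apply: hl|]; rewrite size_rcons // ltnW.
  by rewrite /position mk ?size_rcons // -(size_rcons h x) take_size.
move=> r rh.
have hr : legal (rcons h r).
  move=> j; rewrite size_rcons ltnS => jh x; rewrite -cats1 take_cat nth_cat.
  have [jlt | ] := ltnP j (size h); first exact: hl.
  by move=> hj; rewrite (_ : j - size h = 0) ?cats0 //; apply/eqP; rewrite subn_eq0.
exists (s (rcons h r)); have [] := swin (nth r (rcons h r)) (size h).
  by move=> j jh; rewrite /position mk; [apply: hr|]; rewrite size_rcons // ltnW.
have take_h : take (size h) (rcons h r) = h by rewrite -cats1 take_size_cat.
have take_hr : take (size h).+1 (rcons h r) = rcons h r by rewrite -(size_rcons h r) take_size.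
rewrite /position !mk ?size_rcons // take_h take_hr nth_rcons ltnn eqxx => mv rin _.
by split=> //; exists (rcons h r).
Qed.

Lemma gamma_m_eternal_le n : defendable e n -> gamma_m_eternal e <= n.
Proof. by rewrite /gamma_m_eternal; case: ex_minnP => m _ mle /asboolP /mle. Qed.

Lemma gamma_m_eternal_defendable : defendable e (gamma_m_eternal e).
Proof. by rewrite /gamma_m_eternal; case: ex_minnP => m /asboolP. Qed.

Lemma gamma_cP : (forall x y, connect e x y) ->
  exists D, [/\ dominating e D, connected_in e D & #|D| = gamma_c e].
Proof.
move=> econn; rewrite /gamma_c; case: arg_minnP => [|D /andP [] *]; last by exists D.
apply/andP; split; first by apply/forallP=> x; rewrite inE.
apply/forall_inP=> x _; apply/forall_inP=> y _.
by rewrite (eq_connect (e' := e)) // => u v /=; rewrite !inE.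
Qed.

Lemma gamma_c_le D : (forall x y, connect e x y) ->
  dominating e D -> connected_in e D -> gamma_c e <= #|D|.
Proof.
move=> econn domD conD; rewrite /gamma_c; case: arg_minnP => [|D' _ -> //]; last exact/andP.
apply/andP; split; first by apply/forallP=> x; rewrite inE.
apply/forall_inP=> x _; apply/forall_inP=> y _.
by rewrite (eq_connect (e' := e)) // => u v /=; rewrite !inE.
Qed.

End Game.

(** * Defence along a spanning forest *)

Section ForestStrategy.
Variables (V : finType) (e f : rel V).
Hypotheses (fsym : symmetric f) (fe : subrel f e).
Hypothesis f_nbr : forall x, exists y, f x y.

(** On a simple path an inner vertex has a predecessor and a distinct successor. *)
Lemma path_inner_nleaf x p y : path f x p -> uniq (x :: p) ->
  y \in p -> y != last x p -> ~~ leaf f y.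
Proof.
move=> + up yp; case/splitPr: yp up => p1 [|z p2] up; first by rewrite last_cat /= eqxx.
rewrite cat_path /= => /and4P [_ pr nx _] _.
rewrite fsym in pr; apply/(leafPn pr); exists z => //.
apply: contraTneq up => ->.
rewrite -cat_cons cat_uniq; apply/negP=> /and3P [_ /hasPn no _].
have /no /negP [] : last x p1 \in [:: y, last x p1 & p2] by rewrite !inE eqxx orbT.
exact: mem_last.
Qed.

(* At least one occupied leaf per component suffices for the defence. *)
Definition one_leaf_config (D : {set V}) :=
  (forall x, ~~ leaf f x -> x \in D) /\
  forall x, exists z, [/\ z \in D, leaf f z & connect f x z].

(* An attack on the leaf [r] is answered by advancing every guard on the path from
   the occupied leaf [z] of its component to [r]; [next] is the identity off the path. *)
Lemma one_leaf_config_secure : secure e one_leaf_config.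
Proof.
have fcsym := sym_connect_sym fsym.
move=> D [Dint Dleaf]; split.
  apply/forallP=> x; apply/implyP=> xD; apply/exists_inP.
  have lx : leaf f x by apply: contraNT xD; apply: Dint.
  have [y fxy] := f_nbr x; exists y; last exact: fe.
  have [ly | /Dint //] := boolP (leaf f y).
  have [z [zD lz /connect_pair]] := Dleaf x.
  have fyx : f y x by rewrite fsym.
  case/(_ y (fun t ft => leaf_uniq lx ft fxy) (fun t ft => leaf_uniq ly ft fyx))/set2P => Dz.
    by rewrite -Dz zD in xD.
  by rewrite -Dz.
move=> r rD.
have lr : leaf f r by apply: contraNT rD; apply: Dint.
have [z [zD lz]] := Dleaf r; rewrite fcsym => /connectP [p0 p0P r_p0].
move: p0P r_p0; case/shortenP=> p pP p_uniq _ r_p.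
pose P := z :: p; pose g := next P.
have gK : cancel (prev P) g by apply: next_prev.
have ginj : injective g by apply: can_inj (prev_next p_uniq).
have rP : r \in P by rewrite r_p mem_last.
(* [next] wraps around from [r] to [z], but no guard uses this step since [r] is unoccupied. *)
have gr : g r = z.
  by rewrite /g next_nth rP r_p index_last // /P nth_default.
have PD x : x \in P -> x != r -> x \in D.
  rewrite inE => /orP [/eqP -> // | xp] xr.
  by apply: Dint; apply: path_inner_nleaf pP p_uniq xp _; rewrite -r_p.
have gD x : x \in D -> x \notin P -> x \in g @: D.
  by move=> xD xP; apply/imsetP; exists x => //; rewrite /g next_nth (negPf xP).
have gP x : x \in P -> x != z -> x \in g @: D.
  move=> xP xz; apply/imsetP; exists (prev P x); last by rewrite gK.
  apply: PD; first by rewrite mem_prev.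
  by apply: contraNneq xz => Dx; rewrite -(gK x) Dx gr.
exists (g @: D); split.
- split=> [x nlx | x].
    have [xP | xP] := boolP (x \in P); last by apply: gD => //; apply: Dint.
    by apply: gP => //; apply: contraNneq nlx => ->.
  have zr : r != z by apply: contraNneq rD => ->.
  (* In the component of [z] the attacked leaf [r] becomes the occupied one; the other components do
     not meet the path and keep theirs. *)
  have [cxz | ncxz] := boolP (connect f x z).
    exists r; split=> //; first exact: gP.
    by apply: connect_trans cxz _; apply/connectP; exists p.
  have [y [yD ly cxy]] := Dleaf x; exists y; split=> //.
  apply: gD => //; apply: contra ncxz => yP; apply: connect_trans cxy _; rewrite fcsym.
  exact: path_connect pP y yP.
- exists g; split=> // [x y _ _ | x xD]; first exact: ginj.
  have [xP | xP] := boolP (x \in P); last by left; rewrite /g next_nth (negPf xP).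
  right; apply: fe.
  have cyc : cycle [rel s t | f s t || (s == r)] P.
    rewrite /P /= rcons_path -r_p /= eqxx orbT andbT.
    by apply: sub_path pP => s t /= ->.
  by have /= /orP [//|/eqP Dx] := next_cycle cyc xP; rewrite Dx (negPf rD) in xD.
- by apply: gP => //; apply: contraNneq rD => ->.
Qed.

End ForestStrategy.

(** * Components of a forest *)

Section Components.
Variables (V : finType) (f : rel V).
Hypothesis fsym : symmetric f.
Implicit Types x y : V.

Definition component x : {set V} := [set y | connect f x y].

Lemma componentsE : components f = [set component x | x in [set: V]].
Proof.
by apply: eq_in_imset => x _; apply/setP=> y; rewrite !inE.
Qed.

Lemma component_in x : component x \in components f.
Proof. by rewrite componentsE imset_f. Qed.

Lemma componentsP C : C \in components f -> exists x, C = component x.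
Proof. by rewrite componentsE => /imsetP [x _ ->]; exists x. Qed.

Lemma component_eq x y : connect f x y -> component x = component y.
Proof.
by move=> xy; apply/setP=> z; rewrite !inE (same_connect (sym_connect_sym fsym) xy).
Qed.

Lemma component_pair x y : (forall z, f x z -> z = y) -> (forall z, f y z -> z = x) ->
  #|component x| <= 2.
Proof.
move=> fx fy; apply: (@leq_trans #|[set x; y]|); last by rewrite cards2; case: (x != y).
by apply/subset_leq_card/subsetP=> z; rewrite inE; apply: connect_pair.
Qed.

Lemma component_K2_or_big C : irreflexive f -> (forall x, exists y, f x y) ->
  C \in components f -> is_K2 f C \/ 3 <= #|C|.
Proof.
move=> firr f_nbr /componentsP [x ->]; have [y fxy] := f_nbr x.
have xy : x != y by apply: contraTneq fxy => ->; rewrite firr.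
have sub : [set x; y] \subset component x.
  by apply/subsetP=> z /set2P [] ->; rewrite inE ?connect0 ?connect1.
have [big | small] := ltnP 2 #|component x|; [by right | left].
apply/existsP; exists x; apply/existsP; exists y; rewrite fxy /= eq_sym eqEcard sub cards2 xy.
exact: small.
Qed.

End Components.

(** * Internal vertices in connected dominating sets *)

Definition internal (V : finType) (e : rel V) : {set V} := [set v | ~~ leaf e v].

(** If [D] missed an internal [v], then two neighbours of [v] would each reach [D] without using
    [v], and the connectedness of [D] would join them around [v]. *)
Lemma internal_sub_connected_dominating (V : finType) (e : rel V) (D : {set V}) :
  is_tree e -> 1 < #|V| -> dominating e D -> connected_in e D -> internal e \subset D.
Proof.
move=> e_tree V_gt1 domD conD; have [[esym eirr _] _ econn] := e_tree.
apply/subsetP=> v; rewrite inE => nlv; apply: contraT => vD.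
(* A vertex of degree zero would also count as internal; [1 < #|V|] rules it out. *)
have [y evy] : exists y, e v y.
  have [x xv] : exists x, x != v.
    have /card_gt1P [x [y [_ _ xy]]] := V_gt1.
    by have [<- | ] := eqVneq x v; [exists y; rewrite eq_sym | exists x].
  have /connectP [[|y p] /= pP Dx] := econn v x; first by rewrite Dx eqxx in xv.
  by case/andP: pP => evy _; exists y.
have [z evz zy] := leafPn evy nlv.
set av := [rel s t | [&& s != v, t != v & e s t]].
have neD x : x \in D -> x != v by apply: contraTneq => ->.
have guard x : e v x -> exists2 d, d \in D & connect av x d.
  move=> evx; have [xD | xD] := boolP (x \in D); first by exists x.
  have /forallP /(_ x) /implyP /(_ xD) /exists_inP [d dD exd] := domD.
  exists d => //; apply: connect1; rewrite /= exd (neD d dD) !andbT.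
  by apply: contraTneq evx => ->; rewrite eirr.
have [[d dD cyd] [d' d'D czd']] := (guard y evy, guard z evz).
have avsym : connect_sym av.
  by apply: sym_connect_sym => s t /=; rewrite esym andbCA.
have /negP [] := avoiding_cycle e_tree evz evy zy.
apply: connect_trans czd' _; rewrite avsym; apply: connect_trans cyd _.
have /forall_inP /(_ d dD) /forall_inP /(_ d' d'D) := conD.
by apply: connect_sub => s t /= /and3P [sD tD est]; apply: connect1; rewrite /= est !neD.
Qed.

(** * Rooted trees: children, bottom-up labels and subtrees *)

Section Rooted.
Variables (V : finType) (e : rel V) (root : V) (par : V -> V) (depth : V -> nat).
Hypothesis e_root : rooting e root par depth.
Implicit Types (u v w x y : V) (A D : {set V}).

Let par_root : par root = root. Proof. by case: e_root. Qed.
Let depth_par v : v != root -> depth v = (depth (par v)).+1.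
Proof. by case: e_root => _ + _; apply. Qed.
Let edgeE x y : e x y = (x != root) && (y == par x) || (y != root) && (x == par y).
Proof. by case: e_root. Qed.

Definition kids v : {set V} := [set w | (w != root) && (par w == v)].

Lemma kidsP w v : reflect (w != root /\ par w = v) (w \in kids v).
Proof. by rewrite inE; apply: (iffP andP) => -[? /eqP]. Qed.

Lemma par_edge v : v != root -> e v (par v).
Proof. by move=> vr; rewrite edgeE vr eqxx. Qed.

Lemma kid_edge w v : w \in kids v -> e v w.
Proof. by case/kidsP=> wr <-; rewrite edgeE wr eqxx orbT. Qed.

Lemma edge_kids x y : e x y -> x != root /\ y = par x \/ y \in kids x.
Proof. by rewrite edgeE inE => /orP [] /andP [xr /eqP ->]; [left|right; rewrite xr eqxx]. Qed.

Lemma kids_depth w v : w \in kids v -> depth w = (depth v).+1.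
Proof. by case/kidsP=> /depth_par -> ->. Qed.

Lemma kid_nonleaf w v : v != root -> w \in kids v -> ~~ leaf e v.
Proof.
move=> vr wv; apply/(leafPn (par_edge vr)); exists w; first exact: kid_edge.
apply/eqP=> Dw; have := kids_depth wv; rewrite Dw (depth_par vr).
by move/eqP; rewrite -addn2 -{1}[depth _]addn0 eqn_add2l.
Qed.

Lemma leaf_kids v : v != root -> leaf e v -> kids v = set0.
Proof.
move=> vr lv; apply/eqP; apply: contraLR lv => /set0Pn [w].
exact: kid_nonleaf.
Qed.

Lemma rooted_ind (P : V -> Prop) :
  (forall v, (forall w, w \in kids v -> P w) -> P v) -> forall v, P v.
Proof.
move=> IP v; have [n] := ubnP (\max_u depth u - depth v).
elim: n v => // n IH v vn; apply: IP => w wv; apply: IH.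
rewrite -ltnS; apply: leq_trans vn; rewrite (kids_depth wv) subnS ltnS ltn_predL subn_gt0.
by rewrite -(kids_depth wv); apply: leq_bigmax.
Qed.

(** The recursive rule is iterated from an arbitrary start. The label of [v] is settled after [n]
    rounds once [depth v + n] exceeds the maximal depth. *)
Lemma labelling_exists : exists L : {set V}, forall v, (v \in L) = (#|kids v :&: L| != 1).
Proof.
pose fix lab n : {set V} :=
  if n is n'.+1 then [set v | #|kids v :&: lab n'| != 1] else [set: V].
pose M := \max_u depth u.
have stable n v : M < depth v + n -> (v \in lab n) = (v \in lab n.+1).
  elim: n v => [|n IH] v; first by rewrite addn0 ltnNge /M leq_bigmax.
  rewrite addnS => Mlt; rewrite inE [in RHS]inE; congr (_ != _); apply: eq_card => w.
  rewrite !in_setI; have [wv /= | //] := boolP (w \in kids v).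
  by apply: IH; rewrite (kids_depth wv).
exists (lab M.+1) => v; rewrite inE; congr (_ != _); apply: eq_card => w.
rewrite !in_setI; have [wv /= | //] := boolP (w \in kids v).
by apply: stable; rewrite (kids_depth wv) addSn ltnS leq_addl.
Qed.

Definition below v : {set V} := [set u | fconnect par u v].

Lemma below_depth u v : u \in below v -> depth v <= depth u.
Proof.
rewrite inE => /connectP [p + ->]; elim: p u => //= w p IH u /andP [/eqP Dw /IH].
have [ur | ur] := eqVneq u root; first by rewrite -Dw ur par_root.
by rewrite (depth_par ur) -Dw => /leq_trans; apply.
Qed.

Lemma below_refl v : v \in below v.
Proof. by rewrite inE. Qed.

Lemma below_par u v : (u \in below v) = (u == v) || (par u \in below v).
Proof.
rewrite !inE; have [-> | uv] := eqVneq u v; first by rewrite connect0.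
apply/idP/idP => [|puv]; last by apply: connect_trans puv; apply: connect1; rewrite /= eqxx.
case/connectP=> -[|w p] /=; first by move=> _ Dv; rewrite Dv eqxx in uv.
by case/andP=> /eqP -> pP Dv; apply/connectP; exists p.
Qed.

Lemma below_root u : u \in below root.
Proof.
have [n] := ubnP (depth u); elim: n u => // n IH u un.
have [-> | ur] := eqVneq u root; first exact: below_refl.
by rewrite below_par IH ?orbT // -ltnS -depth_par.
Qed.

(** Membership is written as a number so that the partition of a subtree into its top and the
    subtrees of the children can be summed over any set. *)
Lemma below_kids u v : (u \in below v : nat) = (u == v) + \sum_(w in kids v) (u \in below w).
Proof.
have [n] := ubnP (depth u); elim: n u => // n IH u un.
have [-> | ur] := eqVneq u root.
  have rootE w : (root \in below w) = (root == w).
    have [<- | rw] := eqVneq; first exact: below_refl.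
    rewrite inE; apply/negP=> /connectP [p pP Dw]; case/eqP: rw; rewrite Dw.
    by elim: p pP {Dw} => //= w' p IHp; rewrite par_root => /andP [/eqP <-].
  rewrite rootE big1 ?addn0 // => w /kidsP [wr _].
  by rewrite rootE eq_sym (negPf wr).
rewrite (eq_bigr (fun w => (u == w) + (par u \in below w))); last first.
  move=> w _; rewrite below_par; have [Du | //] := eqVneq u w.
  suff /negPf -> : par u \notin below w by [].
  by apply/negP=> /below_depth; rewrite -Du (depth_par ur) ltnn.
have par_sum : \sum_(w in kids v) (u == w) = (par u == v).
  have [Dv | Dv] := eqVneq (par u) v; last first.
    by rewrite big1 // => w /kidsP [_ Dw]; case: eqP => // Du; rewrite -Dw Du eqxx in Dv.
  rewrite (bigD1 u) ?eqxx /=; last by apply/kidsP.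
  by rewrite big1 // => w /andP [_ /negPf]; rewrite eq_sym => ->.
rewrite big_split /= par_sum -IH; last by rewrite -ltnS -depth_par.
rewrite below_par; have [Duv | //] := eqVneq u v; suff /negPf -> : par u \notin below v by [].
by apply/negP=> /below_depth; rewrite -Duv (depth_par ur) ltnn.
Qed.

Lemma card_setI_below A v :
  #|A :&: below v| = (v \in A) + \sum_(w in kids v) #|A :&: below w|.
Proof.
have cardE B : #|A :&: B| = \sum_(u in A) (u \in B).
  rewrite -sum1_card (eq_bigl (fun u => (u \in A) && (u \in B))) => [|u]; last by rewrite inE.
  by rewrite big_mkcondr; apply: eq_bigr => u _; case: (u \in B).
rewrite cardE (eq_bigr _ (fun u _ => below_kids u v)) big_split /=; congr (_ + _).
  have [vA | vA] := boolP (v \in A).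
    by rewrite (bigD1 v) //= eqxx big1 // => u /andP [_ /negPf ->].
  by rewrite big1 // => u uA; case: eqP => // Du; rewrite -Du uA in vA.
by rewrite exchange_big; apply: eq_bigr => w _; rewrite cardE.
Qed.

(** The only way into the subtree is the edge from [par v], where no guard stands. *)
Lemma guards_move_below D D' v : guards_move e D D' -> v != root -> par v \notin D ->
  #|D' :&: below v| <= #|D :&: below v|.
Proof.
case=> g [_ gstep ->] vr pvD.
apply: leq_trans (leq_imset_card g _); apply: subset_leq_card.
apply/subsetP=> y /setIP [/imsetP [x xD Dy] yv]; rewrite Dy imset_f // inE xD /=.
have [Dg | exg] := gstep x xD; first by rewrite -Dg -Dy.
rewrite -Dy in exg; case: (edge_kids exg) => [[_ Dpx] | yx].
  by rewrite below_par -Dpx yv orbT.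
have [yr Dx] := kidsP _ _ yx.
by move: yv; rewrite below_par Dx; case: eqP => //= Dyv; rewrite -Dyv Dx xD in pvD.
Qed.

Section Labelled.
Variable L : {set V}.
Hypothesis labelL : forall v, (v \in L) = (#|kids v :&: L| != 1).

Lemma leaf_label v : v != root -> leaf e v -> v \in L.
Proof. by move=> vr lv; rewrite labelL leaf_kids // set0I cards0. Qed.

(** * Lower bound on guards for a bad labelling *)

Section LowerBound.
Variable F : {set V} -> Prop.
Hypotheses (F_secure : secure e F) (int_kid : {in internal e, forall v, kids v :&: L != set0})
  (root_int : ~~ leaf e root) (rootL : root \in L).

Let forced v (D : {set V}) := exists2 r, r \notin D & forall D', F D' -> guards_move e D D' ->
  r \in D' -> #|internal e :&: below v| < #|D' :&: below v|.

(** Both claims are proved in one induction: when [v] is unoccupied, the forced attacks of its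
    L-kids show that each of their subtrees already holds a surplus, which makes up for the missing
    guard at [v]. *)
Lemma secure_below v D : F D -> #|internal e :&: below v| <= #|D :&: below v| /\
  (v \in L -> #|D :&: below v| <= #|internal e :&: below v| -> forced v D).
Proof.
move: D; elim/rooted_ind: v => v IH D FD.
have [lv | nlv] := boolP (leaf e v).
  have vr : v != root by apply: contraNneq root_int => <-.
  have cardv A : #|A :&: below v| = (v \in A).
    by rewrite card_setI_below leaf_kids // big_set0 addn0.
  rewrite !cardv inE lv /=; split=> // _ vD; exists v; first by case: (v \in D) vD.
  by move=> D' _ _ vD'; rewrite !cardv inE lv vD'.
have vI : v \in internal e by rewrite inE.
pose sI := \sum_(w in kids v) #|internal e :&: below w|.
have cI : #|internal e :&: below v| = sI.+1 by rewrite card_setI_below vI.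
pose sD D' := \sum_(w in kids v) #|D' :&: below w|.
have le_sum D' : F D' -> sI <= sD D'.
  by move=> FD'; apply: leq_sum => w wv; case: (IH w wv D' FD').
(* An L-kid holding only the minimum needs a reinforcement from [v]. *)
have strict D' w : F D' -> v \notin D' -> w \in kids v :&: L ->
    #|internal e :&: below w| < #|D' :&: below w|.
  move=> FD' vD' /setIP [wv wL]; rewrite ltnNge; apply/negP=> low.
  have [wr Dpw] := kidsP _ _ wv.
  have [_ /(_ wL low) [r rD' rF]] := IH w wv D' FD'.
  have [_ /(_ r rD') [D'' [FD'' mv rD'']]] := F_secure FD'.
  have := guards_move_below mv wr; rewrite Dpw => /(_ vD') back.
  by have := leq_trans (rF D'' FD'' mv rD'') (leq_trans back low); rewrite ltnn.
have sum_strict D' : F D' -> v \notin D' -> sI + #|kids v :&: L| <= sD D'.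
  move=> FD' vD'; rewrite /sI /sD -sum1_card.
  rewrite (big_mkcond (mem (kids v))) (big_mkcond (mem (kids v :&: L))) [X in _ <= X]big_mkcond.
  rewrite -big_split; apply: leq_sum => w _ /=; rewrite in_setI.
  have [wv /= | //] := boolP (w \in kids v).
  case: ifP => wL; first by rewrite addn1; apply: strict; rewrite // in_setI wv.
  by rewrite addn0; case: (IH w wv D' FD').
have nL := int_kid vI; rewrite -card_gt0 in nL.
rewrite cI card_setI_below -/(sD D); have [vD | vD] := boolP (v \in D); last first.
  have sumD := sum_strict D FD vD; rewrite add0n; split.
    by apply: leq_trans sumD; rewrite -addn1 leq_add2l.
  (* A vertex of [L] with an L-kid has at least two, so their surpluses exceed the one guard missing
     at [v]. *)
  rewrite labelL => nL1 low; have := leq_trans sumD low.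
  by rewrite -addn1 leq_add2l leqNgt ltn_neqAle eq_sym nL1 nL.
split=> [|vL]; first by rewrite add1n ltnS le_sum.
rewrite add1n ltnS => low; have [w /setIP [wv wL]] := set0Pn _ (int_kid vI).
(* As [v] is occupied, a minimal total leaves no surplus in any child, so the attack forced below
   [w] is available. *)
have low_w : #|D :&: below w| <= #|internal e :&: below w|.
  rewrite leqNgt; apply/negP=> high; have := low; rewrite leqNgt => /negP; apply.
  rewrite /sI /sD (bigD1 w) // [X in _ < X](bigD1 w) //= -addSn leq_add //.
  by apply: leq_sum => w' /andP [w'v _]; case: (IH w' w'v D FD).
have [_ /(_ wL low_w) [r rD rF]] := IH w wv D FD; exists r => // D' FD' mv rD'.
(* If [v] is still occupied, the surplus below [w] passes to [v]; if not, at least two L-kids hold a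
   surplus. *)
rewrite cI card_setI_below -/(sD D'); have [vD' | vD'] := boolP (v \in D').
  rewrite add1n ltnS /sI /sD (bigD1 w) // [X in _ < X](bigD1 w) //= -addSn leq_add //.
    exact: rF.
  by apply: leq_sum => w' /andP [w'v _]; case: (IH w' w'v D' FD').
rewrite add0n; apply: leq_trans (sum_strict D' FD' vD').
by rewrite -addn2 leq_add2l ltn_neqAle eq_sym -labelL vL.
Qed.

(** At the root a forced surplus would change the total number of guards, which moves preserve. *)
Lemma internal_lt_secure D : F D -> #|internal e| < #|D|.
Proof.
have full A : A :&: below root = A.
  by apply/setIidPl/subsetP => u _; apply: below_root.
move=> FD; have [] := secure_below root FD; rewrite /forced !full.
rewrite leq_eqVlt => /orP [/eqP eqID | //] /(_ rootL); rewrite -eqID leqnn => /(_ isT) [r rD rF].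
have [_ /(_ r rD) [D' [FD' mv rD']]] := F_secure FD.
by move: (rF D' FD' mv rD'); rewrite !full (guards_move_card mv) -eqID.
Qed.

End LowerBound.
End Labelled.

Lemma par_nonleaf v : ~~ leaf e root -> v != root -> ~~ leaf e (par v).
Proof.
move=> rootI vr; have [-> // | pr] := eqVneq (par v) root.
by apply: (kid_nonleaf (w := v)) => //; apply/kidsP.
Qed.

(** Parents are internal, so leaves are dominated and internal vertices climb to the root through
    internal ones. *)
Lemma gamma_c_le_internal : ~~ leaf e root -> (forall x y, connect e x y) ->
  gamma_c e <= #|internal e|.
Proof.
move=> rootI econn; apply: gamma_c_le => //.
  apply/forallP=> x; apply/implyP; rewrite inE negbK => lx.
  have xr : x != root by apply: contraNneq rootI => <-.
  by apply/exists_inP; exists (par x); rewrite ?inE ?par_nonleaf ?par_edge.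
rewrite /connected_in; set eI := (X in connect X).
have eIsym : connect_sym eI.
  by apply: sym_connect_sym => s t; rewrite /eI /= andbCA edgeE orbC -edgeE.
have up x : x \in internal e -> connect eI x root.
  have [n] := ubnP (depth x); elim: n x => // n IH x xn xI.
  have [-> // | xr] := eqVneq x root.
  have pI : par x \in internal e by rewrite inE par_nonleaf.
  apply: connect_trans (IH (par x) _ pI); last by rewrite -ltnS -depth_par.
  by apply: connect1; rewrite /eI /= xI pI par_edge.
apply/forall_inP=> x xI; apply/forall_inP=> y yI.
by apply: connect_trans (up x xI) _; rewrite eIsym up.
Qed.

(** * The spanning forest of a good labelling *)

Section LabelForest.
Variables (L : {set V}) (l1 : V).
Hypotheses (e_tree : is_tree e) (V_gt1 : 1 < #|V|).
Hypothesis labelL : forall v, (v \in L) = (#|kids v :&: L| != 1).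
Hypotheses (l1_kid : l1 \in kids root) (l1_leaf : leaf e l1).

Definition label_forest x y :=
  [&& x != root, y == par x & x \in L] || [&& y != root, x == par y & y \in L].
Local Notation f := label_forest.

Lemma label_forest_sym : symmetric f.
Proof. by move=> x y; rewrite /f orbC. Qed.

Lemma label_forest_sub : subrel f e.
Proof. by move=> x y; rewrite edgeE => /orP [] /and3P [-> -> _]; rewrite ?orbT. Qed.

Lemma label_forestP x y : f x y -> [/\ x != root, x \in L & y = par x] \/ y \in kids x :&: L.
Proof.
case/orP=> /and3P [xr /eqP Dy xL]; first by left.
by right; rewrite in_setI xL andbT; apply/kidsP.
Qed.

Lemma label_forest_par v : v != root -> v \in L -> f v (par v).
Proof. by move=> vr vL; rewrite /f vr vL eqxx. Qed.

Lemma label_forest_kid w v : w \in kids v :&: L -> f v w.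
Proof. by case/setIP=> /kidsP [wr <-] wL; rewrite label_forest_sym label_forest_par. Qed.

Let l1_nroot : l1 != root. Proof. by case/kidsP: l1_kid. Qed.
Let l1_par : par l1 = root. Proof. by case/kidsP: l1_kid. Qed.
Let l1L : l1 \in L. Proof. exact: (leaf_label labelL). Qed.
Let root_l1 : l1 \in kids root :&: L. Proof. by rewrite in_setI l1_kid l1L. Qed.

Lemma label_forest_nbr x : exists y, f x y.
Proof.
have [-> | xr] := eqVneq x root; first by exists l1; apply: label_forest_kid.
have [xL | ] := boolP (x \in L); first by exists (par x); apply: label_forest_par.
rewrite labelL negbK => /cards1P [w Dw]; exists w.
by apply: label_forest_kid; rewrite Dw set11.
Qed.

Lemma label_forest_leaf v : v \notin L -> leaf f v.
Proof.
move=> vL; have := vL; rewrite labelL negbK => /cards1P [w Dw].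
apply: (leaf1 (y := w)) => [|z /label_forestP [[_] | ]]; last by rewrite Dw => /set1P.
  by apply: label_forest_kid; rewrite Dw set11.
by rewrite (negPf vL).
Qed.

(** Here [v] is cut off from its parent, [w] is its only L-kid, and [w] has no children. Thus a
    large component has no such top. *)
Lemma label_forest_pair v w : v \notin L -> w \in kids v :&: L -> leaf e w ->
  #|component f v| <= 2.
Proof.
move=> vL wv lw; have [wkid _] := setIP wv; have [wr Dv] := kidsP _ _ wkid.
apply: (component_pair (y := w)) => z /label_forestP [[zr zL ->] | zk].
- by rewrite zL in vL.
- exact: leaf_uniq (label_forest_leaf vL) (label_forest_kid zk) (label_forest_kid wv).
- exact: Dv.
- by rewrite leaf_kids // set0I inE in zk.
Qed.

(** The forest leaves whose only edge goes up; these are the vertices that the defence may leave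
    empty. *)
Definition label_ends : {set V} := [set v | (v != root) && (kids v :&: L == set0)].

Lemma label_ends_leaf v : v \in label_ends -> leaf f v.
Proof.
rewrite inE => /andP [vr /eqP v0].
have vL : v \in L by rewrite labelL v0 cards0.
apply: (leaf1 (label_forest_par vr vL)) => z /label_forestP [[] // | ].
by rewrite v0 inE.
Qed.

Lemma l1_ends : l1 \in label_ends.
Proof. by rewrite inE l1_nroot leaf_kids // set0I /=. Qed.

Lemma label_forest_inner v : ~~ leaf f v -> v \notin label_ends.
Proof. by apply: contra => /label_ends_leaf. Qed.

(** Climbing forest edges stops only at the root or at a vertex outside [L]. *)
Lemma label_forest_top x : exists2 t, connect f x t & t = root \/ t != root /\ t \notin L.
Proof.
have [n] := ubnP (depth x); elim: n x => // n IH x xn.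
have [-> | xr] := eqVneq x root; first by exists root; [apply: connect0 | left].
have [xL | xL] := boolP (x \in L); last by exists x; [apply: connect0 | right].
have [|t pt tP] := IH (par x); first by rewrite -ltnS -depth_par.
by exists t => //; apply: connect_trans pt; apply/connect1/label_forest_par.
Qed.

Lemma nonlabel_nends v : v \notin L -> v \notin label_ends.
Proof.
rewrite labelL negbK inE negb_and => /eqP v1; apply/orP; right.
by rewrite -cards_eq0 v1.
Qed.

Lemma one_leaf_config_label1 : root \notin L -> one_leaf_config f (~: label_ends).
Proof.
move=> rL; split=> [x /label_forest_inner | x]; first by rewrite in_setC.
have [t xt tP] := label_forest_top x.
have tL : t \notin L by case: tP => [-> | []].
by exists t; rewrite in_setC nonlabel_nends // label_forest_leaf.
Qed.

(** If the root is in [L], its component need not have a top that is a leaf, so [l1] is added as its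
    occupied leaf. *)
Lemma one_leaf_config_label2 : one_leaf_config f (l1 |: ~: label_ends).
Proof.
split=> [x /label_forest_inner | x]; first by rewrite !inE => ->; rewrite orbT.
have [t xt [Dt | [_ tL]]] := label_forest_top x.
  exists l1; rewrite setU11 label_ends_leaf ?l1_ends //; split=> //.
  by apply: connect_trans xt _; rewrite Dt; apply/connect1/label_forest_kid.
by exists t; rewrite in_setU in_setC nonlabel_nends // orbT label_forest_leaf.
Qed.

Lemma leaf_root_pair v : leaf e root -> v = root \/ v = l1.
Proof.
move=> lr; have [_ _ econn] := e_tree.
have erl := kid_edge l1_kid; have elr : e l1 root by rewrite -[X in e _ X]l1_par par_edge.
have := connect_pair (fun t et => leaf_uniq lr et erl) (fun t et => leaf_uniq l1_leaf et elr)
  (econn root v).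
by case/set2P; [left | right].
Qed.

Lemma nends_internal : ~~ leaf e root -> ~: label_ends \subset internal e.
Proof.
move=> rI; apply/subsetP=> v; rewrite !inE negb_and negbK => /orP [/eqP -> // | ].
have [-> // | vr] := eqVneq v root; case/set0Pn=> w /setIP [wv _].
exact: kid_nonleaf wv.
Qed.

Hypothesis label_good : root \notin L \/ exists2 v, v \in internal e & kids v :&: L = set0.

Lemma label_end_loner : root \in L ->
  exists v, [/\ v \in label_ends, v \in internal e & ~~ leaf e root].
Proof.
move=> rL; case: label_good => [ | [v vI v0]]; first by rewrite rL.
have vr : v != root by apply: contraTneq root_l1 => Dv; rewrite -Dv v0 inE.
exists v; split=> //; first by rewrite inE vr v0 /=.
apply: contraL vI => /(leaf_root_pair v) [Dv | ->]; first by rewrite Dv eqxx in vr.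
by rewrite inE l1_leaf.
Qed.

(** All guards but the extra one at [l1] stand on internal vertices; that one is paid for by an
    internal vertex of [label_ends], which stays empty. *)
Lemma label_defendable : exists2 n, defendable e n & n <= gamma_c e.
Proof.
have Fsec := one_leaf_config_secure label_forest_sym label_forest_sub label_forest_nbr.
have [_ _ econn] := e_tree; have [Dc [domDc conDc Dc_card]] := gamma_cP econn.
have intDc := internal_sub_connected_dominating e_tree V_gt1 domDc conDc.
have [rL | rL] := boolP (root \in L).
  have [v [vend vI rI]] := label_end_loner rL.
  exists #|l1 |: ~: label_ends|; first exact: secure_defendable Fsec one_leaf_config_label2.
  rewrite -Dc_card; apply: leq_trans (subset_leq_card intDc).
  rewrite cardsU1 inE l1_ends /= add1n (cardsD1 v (internal e)) vI add1n ltnS.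
  apply/subset_leq_card/subsetP=> x xend; rewrite in_setD1.
  rewrite (subsetP (nends_internal rI)) // andbT.
  by apply: contraTneq xend => ->; rewrite in_setC vend.
exists #|~: label_ends|; first exact: secure_defendable Fsec (one_leaf_config_label1 rL).
rewrite -Dc_card; have [lr | rI] := boolP (leaf e root); last first.
  exact: leq_trans (subset_leq_card (nends_internal rI)) (subset_leq_card intDc).
(* A leaf root makes the tree a $K_2$, where a single guard suffices. *)
apply: (@leq_trans #|[set root]|).
  apply/subset_leq_card/subsetP=> v; case: (leaf_root_pair v lr) => ->; first by rewrite set11.
  by rewrite in_setC l1_ends.
rewrite cards1 card_gt0; apply/set0Pn.
have [rD | rD] := boolP (root \in Dc); first by exists root.
have /forallP /(_ root) /implyP /(_ rD) /exists_inP [y yD _] := domDc.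
by exists y.
Qed.

Lemma label_forest_components : exists r k,
  has_components f r k /\ k <= #|[set x | loner e x && leaf f x]|.
Proof.
have [[_ eirr _] _ _] := e_tree.
have firr : irreflexive f.
  by move=> x; apply/negP=> /label_forest_sub; rewrite eirr.
exists #|[set C in components f | is_K2 f C]|, #|[set C in components f | 3 <= #|C|]|.
split; first by split=> // C; apply: component_K2_or_big => //; apply: label_forest_nbr.
set A := (X in _ <= #|X|).
(* [phi] sends loner leaves onto the large components: a top outside [L] represents its own
   component, and a loner in [L] represents that of the root. *)
pose phi x := if x \in L then component f root else component f x.
apply: leq_trans (leq_imset_card phi A); apply/subset_leq_card/subsetP=> C.
rewrite inE => /andP [/componentsP [x ->] big].
have [t xt tP] := label_forest_top x.
rewrite (component_eq label_forest_sym xt) in big *.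
case: tP => [Dt | [tr tL]].
  rewrite Dt in big *; have [rL | rL] := boolP (root \in L); last first.
    by have := leq_trans big (label_forest_pair rL root_l1 l1_leaf).
  have [v [vend vI rI]] := label_end_loner rL.
  have vL : v \in L by move: vend; rewrite inE labelL => /andP [_ /eqP ->]; rewrite cards0.
  apply/imsetP; exists v; last by rewrite /phi vL.
  rewrite inE label_ends_leaf // andbT /loner; move: (vI); rewrite inE => -> /=.
  apply/forallP=> y; apply/implyP=> /edge_kids [[vr ->] | yv]; first exact: par_nonleaf.
  apply/negP=> ly; have [yr _] := kidsP _ _ yv.
  move: vend; rewrite inE => /andP [_ /eqP /setP /(_ y)].
  by rewrite in_setI yv (leaf_label labelL) ?inE.
apply/imsetP; exists t; last by rewrite /phi (negPf tL).
have /existsP [w wt] : [exists w, w \in kids t :&: L].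
  by move: tL; rewrite labelL negbK => /cards1P [w ->]; apply/existsP; exists w; apply: set11.
have wkid : w \in kids t by case/setIP: wt.
rewrite inE label_forest_leaf // andbT /loner (kid_nonleaf tr wkid) /=.
apply/forallP=> y; apply/implyP=> /edge_kids [[_ ->] | yt].
  apply: (par_nonleaf _ tr); apply: contra tL => /(leaf_root_pair t) [Dt | -> //].
  by rewrite Dt eqxx in tr.
(* A leaf child of [t] would be its L-kid and reduce the component to a pair. *)
apply: contraL big => ly; rewrite -leqNgt; apply: (label_forest_pair tL _ ly).
by have [yr _] := kidsP _ _ yt; rewrite in_setI yt (leaf_label labelL).
Qed.

End LabelForest.

Lemma below_anti u v : u \in below v -> v \in below u -> u = v.
Proof.
move=> uv vu; have le_uv := below_depth vu; have le_vu := below_depth uv.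
have climb x y : x \in below y -> depth x <= depth y -> x != root -> x = y.
  rewrite below_par => /orP [/eqP // | /below_depth yx] xy xr.
  by move: xy; rewrite depth_par // ltnNge yx.
have [ur | ur] := eqVneq u root; last exact: climb.
by have [vr | vr] := eqVneq v root; [rewrite ur | apply/esym/climb].
Qed.

(** * Double count for a bad labelling *)

Section SpanningForest.
Variables (L : {set V}) (g : rel V) (r k : nat).
Hypothesis labelL : forall v, (v \in L) = (#|kids v :&: L| != 1).
Hypotheses (int_kid : {in internal e, forall v, kids v :&: L != set0})
  (root_int : ~~ leaf e root) (rootL : root \in L).
Hypotheses (gsym : symmetric g) (girr : irreflexive g) (ge : subrel g e).
Hypothesis g_comp : has_components g r k.

Lemma forest_nbr x : exists y, g x y.
Proof.
have [/(_ _ (component_in g x)) + _ _] := g_comp.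
have xx : x \in component g x by rewrite inE.
case=> [/existsP [a /existsP [b /andP [gab /eqP Dx]]] | big].
  move: xx; rewrite Dx => /set2P [] ->; first by exists b.
  by exists a; rewrite gsym.
have [y] : exists y, y \in component g x :\ x.
  by apply/set0Pn; rewrite -card_gt0; move: big; rewrite (cardsD1 x) xx add1n ltnS; case: #|_|.
rewrite !inE => /andP [yx /connectP [[|z p] /=]]; first by move=> _ Dy; rewrite Dy eqxx in yx.
by case/andP=> gxz; exists z.
Qed.

Let top v := (v == root) || ~~ g v (par v).
Let big v := top v && (2 < #|component g v|).

(** A forest path from a top cannot leave the subtree, whose only exit is the missing edge to the
    parent. *)
Lemma top_below v u : top v -> connect g v u -> u \in below v.
Proof.
move=> tv /connectP [p + ->] {u}.
have: v \in below v by apply: below_refl.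
elim: p {1 3 4}v => //= u p IH t tb /andP [gtu pP]; apply: IH pP.
case: (edge_kids (ge gtu)) => [[tr Du] | /kidsP [ur Dt]]; last by rewrite below_par Dt tb orbT.
move: tb; rewrite below_par -Du => /orP [/eqP Dt | //].
by move: tv; rewrite /top -Dt (negPf tr) -Du gtu.
Qed.

(** Two tops of one component lie below each other and coincide, so large components are counted at
    most once. *)
Lemma sum_big_le : \sum_v big v <= k.
Proof.
have [_ _ <-] := g_comp.
have -> : \sum_v big v = #|[set v | big v]|.
  rewrite -sum1_card big_mkcond [RHS]big_mkcond; apply: eq_bigr => v _ /=.
  by rewrite inE; case: (big v).
rewrite -(@card_in_imset _ _ (component g)); last first.
  move=> u v; rewrite !inE => /andP [tu _] /andP [tv _] Duv.
  have : v \in component g v by rewrite inE.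
  rewrite -Duv inE => uv.
  apply: below_anti; first by apply: top_below tv _; rewrite (sym_connect_sym gsym).
  exact: top_below.
apply/subset_leq_card/subsetP=> _ /imsetP [v + ->]; rewrite !inE => /andP [_ ->].
by rewrite component_in.
Qed.

Let lone v := loner e v && leaf g v.
(* Weight passed from a vertex to its parent in the double count. *)
Let dl v := [&& v \in L, v \in internal e & top v || leaf g v].

(** With [s] L-kids the left side is at most [s], because [dl v] requires [s] to be at least 2. On
    the right, every L-kid not joined to [v] contributes 1; a joined one is compensated by [big v],
    by its own weight, or by [v] not being a loner. *)
Lemma lone_dl_le v : lone v + dl v <= big v + \sum_(w in kids v) dl w.
Proof.
have [lv | nlv] := boolP (leaf e v); first by rewrite /lone /dl /loner inE lv /= andbF.
have vI : v \in internal e by rewrite inE.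
pose s := #|kids v :&: L|.
have s_gt0 : 0 < s by rewrite card_gt0 int_kid.
have dl_le : dl v <= s.-1.
  rewrite /dl labelL -/s; case: (s) s_gt0 => [|[|m]] //= _.
  by apply: leq_trans (leq_b1 _) _.
have sum_ge (B : {set V}) : B \subset kids v -> {in B, forall w, dl w} ->
    #|B| <= \sum_(w in kids v) dl w.
  move=> /subsetP Bv Bdl; rewrite -sum1_card big_mkcond [X in _ <= X]big_mkcond /=.
  apply: leq_sum => w _; have [wB | //] := boolP (w \in B).
  by rewrite Bv // Bdl.
(* Such a [w] is a top, and it is internal because a leaf of the tree would have to be joined to its
   parent [v]. *)
have unlinked w : w \in kids v :&: L -> ~~ g v w -> dl w.
  case/setIP=> wv wL ngvw; have [wr Dpw] := kidsP _ _ wv.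
  rewrite /dl wL /top Dpw [g w v]gsym ngvw orbT andbT inE.
  apply: contra ngvw => lw; have [y gwy] := forest_nbr w.
  by rewrite -Dpw (leaf_uniq lw (par_edge wr) (ge gwy)) gsym.
have all_but w : leaf g v -> g v w -> s.-1 <= \sum_(w in kids v) dl w.
  move=> lgv gvw; apply: (@leq_trans #|(kids v :&: L) :\ w|).
    by rewrite /s (cardsD1 w); case: (w \in _); rewrite ?add1n ?leq_pred.
  apply: sum_ge => [|w' /setD1P [w'w w'v]].
    by apply: subset_trans (subD1set _ _) (subsetIl _ _).
  by apply: unlinked => //; apply: contraNN w'w => gvw'; rewrite (leaf_uniq lgv gvw' gvw).
have all_kids : {in kids v :&: L, forall w, dl w} -> lone v + dl v <= \sum_(w in kids v) dl w.
  move=> /(sum_ge _ (subsetIl _ _)); apply: leq_trans.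
  by rewrite -[leqRHS]prednK // -add1n leq_add ?leq_b1.
have [y gvy] := forest_nbr v.
have [big_v | ] := boolP (big v).
  have [/andP [_ lgv] | _] := boolP (lone v); last first.
    by rewrite add0n (leq_trans (leq_b1 _)) ?leq_addr.
  by rewrite leq_add2l (leq_trans dl_le) // (all_but y).
(* If [v] is not a top and is a leaf of [g], its only edge goes up, so all its L-kids are
   unlinked. *)
rewrite /big negb_and -leqNgt add0n; have [tv /= small | ntv _] := boolP (top v); last first.
  have [lgv | nlgv] := boolP (leaf g v); last by rewrite /lone /dl (negPf ntv) (negPf nlgv) !andbF.
  apply: all_kids => w wv; apply: unlinked => //; apply/negP=> gvw.
  move: ntv; rewrite /top negb_or negbK => /andP [vr gvp].
  have [/kidsP [wr Dpw] _] := setIP wv.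
  have Dw := leaf_uniq lgv gvp gvw.
  have [wkid _] := setIP wv; have := depth_par vr.
  by rewrite Dw (kids_depth wkid) => /eqP; rewrite eqn_leq andbC ltnNge leqnSn.
have vy : v != y by apply: contraTneq gvy => ->; rewrite girr.
have comp_v : component g v = [set v; y].
  apply/esym/eqP; rewrite eqEcard cards2 vy small andbT.
  by apply/subsetP=> z /set2P [] ->; rewrite inE ?connect0 ?connect1.
have gv z : g v z -> z = y.
  move=> gvz; have : z \in component g v by rewrite inE connect1.
  by rewrite comp_v => /set2P [Dz | //]; rewrite Dz girr in gvz.
have gyv : g y v by rewrite gsym.
have gy z : g y z -> z = v.
  move=> gyz; have : z \in component g v.
    by rewrite inE (connect_trans (connect1 gvy)) // connect1.
  by rewrite comp_v => /set2P [// | Dz]; rewrite Dz girr in gyz.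
have lgv := leaf1 gvy gv; have lgy := leaf1 gyv gy.
have yv : y \in kids v.
  case: (edge_kids (ge gvy)) => [[vr Dy] | //].
  by move: tv; rewrite /top (negPf vr) -Dy gvy.
(* The component is the pair of [v] and its child [y]. Either [y] is a leaf of the tree and [v] is
   no loner, or [y] is an internal leaf of [g] that passes weight if it is in [L]. *)
have [ley | nley] := boolP (leaf e y).
  have -> : lone v = false.
    rewrite /lone /loner nlv /=; apply/negP=> /andP [/forallP /(_ y) /implyP].
    by rewrite ley => /(_ (ge gvy)).
  by rewrite add0n (leq_trans dl_le) // (all_but y).
apply: all_kids => w wv; have [gvw | ] := boolP (g v w); last exact: unlinked.
have [_ wL] := setIP wv.
by rewrite /dl wL (gv w gvw) inE nley lgy orbT.
Qed.

(** Summing the local inequality cancels the weight of every vertex but the root, whose weight 1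
    occurs only on the left and gives strictness. *)
Lemma loner_leaves_lt : #|[set x | loner e x && leaf g x]| < k.
Proof.
apply: leq_trans sum_big_le.
have -> : #|[set x | loner e x && leaf g x]| = \sum_v lone v.
  rewrite -sum1_card big_mkcond [RHS]big_mkcond; apply: eq_bigr => v _ /=.
  by rewrite inE /lone; case: (_ && _).
have dl_root : dl root by rewrite /dl rootL inE root_int /top eqxx.
rewrite -(leq_add2r (\sum_(v | v != root) dl v)) addSnnS.
have -> : (\sum_(v | v != root) dl v).+1 = \sum_v dl v by rewrite [RHS](bigD1 root) //= dl_root.
rewrite [\sum_(v | v != root) _](partition_big par xpredT) //= -!big_split /=.
apply: leq_sum => v _.
rewrite [X in _ <= _ + X](eq_bigl (fun w => w \in kids v)); first exact: lone_dl_le.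
by move=> w; rewrite inE.
Qed.

End SpanningForest.
End Rooted.

(** * Assembly of the equivalence *)

Lemma sub_forest (V : finType) (e f : rel V) :
  is_forest e -> symmetric f -> subrel f e -> is_forest f.
Proof.
move=> [_ eirr eacy] fsym fe; split=> // [x | c /andP [fc c_uniq]].
  by apply/negP=> /fe; rewrite eirr.
by apply: eacy; rewrite /ucycle c_uniq (sub_cycle fe).
Qed.

(** A deepest vertex of any rooting is a leaf. *)
Lemma stem_exists (V : finType) (e : rel V) : is_tree e -> 1 < #|V| ->
  exists x y, e x y /\ leaf e y.
Proof.
move=> e_tree /card_gt1P [a [b [_ _ ab]]].
have [par [depth e_root]] := rooting_exists a e_tree.
pose v := [arg max_(v > a) depth v].
have vmax u : depth u <= depth v by rewrite /v; case: arg_maxnP => // w _; apply.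
have va : v != a.
  apply/eqP=> Dv; have := vmax b; have [_ -> //] := e_root; last by rewrite eq_sym.
  by rewrite Dv ltnNge (below_depth e_root) // (below_root e_root).
exists (par v), v; have [[[esym _ _] _ _] evp] := (e_tree, par_edge e_root va).
rewrite esym; split=> //; apply: leaf1 evp _ => z /(edge_kids e_root) [[_ //] | zv].
by have := vmax z; rewrite (kids_depth e_root zv) ltnn.
Qed.

(* Hypothesis 1 < #|V|: the one-vertex tree has gamma_m_eternal = gamma_c = 1
   but no spanning forest of the required kind. *)
Theorem proposition3p1 (V : finType) (e : rel V)
  (e_tree : is_tree e) (V_gt1 : 1 < #|V|) :
  gamma_m_eternal e < 1 + gamma_c e <->
  exists (f : rel V) (r k : nat),
    [/\ is_spanning_forest f e,
        has_components f r k
      & k <= #|[set x | loner e x && leaf f x]|].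
Proof.
have [root [l1 [e_rl1 l1_leaf]]] := stem_exists e_tree V_gt1.
have [par [depth e_root]] := rooting_exists root e_tree.
have [forest_e _ econn] := e_tree.
have l1_kid : l1 \in kids root par root.
  by case: (edge_kids e_root e_rl1) => // -[]; rewrite eqxx.
have [L labelL] := labelling_exists e_root.
have [good | bad] := pselect
  (root \notin L \/ exists2 v, v \in internal e & kids root par v :&: L = set0).
  split=> _; last first.
    have [n defn nle] := label_defendable e_root e_tree V_gt1 labelL l1_kid l1_leaf good.
    by rewrite add1n ltnS; apply: leq_trans (gamma_m_eternal_le defn) nle.
  have [r [k [comp kle]]] := label_forest_components e_root e_tree labelL l1_kid l1_leaf good.
  exists (label_forest root par L), r, k; split=> //.
  have sub := label_forest_sub e_root (L := L).
  split; last exact: sub.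
  exact: sub_forest forest_e (label_forest_sym _ _ _) sub.
have rootL : root \in L by apply: contra_notT bad => ?; left.
have int_kid : {in internal e, forall v, kids root par v :&: L != set0}.
  by move=> v vI; apply: contra_notN bad => /eqP v0; right; exists v.
(* A leaf root would have [l1] as its only child, a child in [L], and so would lie outside [L]. *)
have root_int : ~~ leaf e root.
  apply: contraL rootL => lr; rewrite labelL negbK; apply/cards1P; exists l1.
  apply/setP=> w; rewrite in_setI in_set1; apply/andP/eqP=> [[wr _] | ->].
    exact: leaf_uniq lr (kid_edge e_root wr) e_rl1.
  by split=> //; apply: (leaf_label e_root labelL) l1_leaf; case/kidsP: l1_kid.
split=> [gamma_lt | [f [r [k [[[fsym firr _] fe] comp kle]]]]].
  have [F [Fsec [D FD Dcard]]] := defendable_secure (gamma_m_eternal_defendable e).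
  have := internal_lt_secure e_root labelL Fsec int_kid root_int rootL FD.
  rewrite Dcard => /leq_ltn_trans /(_ gamma_lt).
  by rewrite add1n !ltnS ltnNge (gamma_c_le_internal e_root root_int econn).
have := loner_leaves_lt e_root labelL int_kid root_int rootL fsym firr fe comp.
by rewrite ltnNge kle.
Qed.
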